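(* Let $n\ge 1$, let $\alpha_1,\alpha_2,\lambda_1,\lambda_2>0$, and let $\beta_1,\dots,\beta_n>0$ and $\beta_1^*,\dots,\beta_n^*>0$. Let $X_1,\dots,X_n$ be independent random variables with $X_i\sim \mathrm{ENH}(\alpha_1,\lambda_1,\beta_i)$, and let $X_1^*,\dots,X_n^*$ be independent random variables with $X_i^*\sim \mathrm{ENH}(\alpha_2,\lambda_2,\beta_i^* )$, $i=1,\dots,n$. Write $X_{n:n}=\max_i X_i$ and $X^*_{n:n}=\max_i X_i^*$. If $\alpha_1\le\alpha_2$ and $\sum_{i=1}^n\beta_i=\sum_{i=1}^n\beta_i^*$, then $X_{n:n}\ge_{\mathrm{c}}X^*_{n:n}$.
   Context: For $\alpha,\lambda,\beta>0$, $X\sim \mathrm{ENH}(\alpha,\lambda,\beta)$ (exponentiated Nadarajah-Haghighi distribution) means that $X$ is a positive random variable with distribution function $[1-\exp\{1-(1+\lambda x)^{\alpha}\}]^{\beta}$ for $x>0$ (and $0$ for $x\le 0$). Convex transform order: for non-negative random variables $X,Y$ with distribution functions $F,G$, $X\le_{\mathrm{c}}Y$ (equivalently $Y\ge_{\mathrm{c}}X$) means that $G^{-1}(F(x))$ is convex in $x\ge 0$, where $G^{-1}(u)=\sup\{x\in\mathbb{R}:G(x)\le u\}$ is the right continuous inverse of $G$. *)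

(* Defs.v *)
From HB Require Import structures.
From mathcomp Require Import all_boot all_order all_algebra.
From mathcomp Require Import all_classical all_reals all_analysis measurable_realfun.

Set Implicit Arguments.
Unset Strict Implicit.
Unset Printing Implicit Defensive.

Import Order.TTheory GRing.Theory Num.Theory.
Import numFieldNormedType.Exports.

Local Open Scope classical_set_scope.
Local Open Scope ring_scope.

(* For a finite family the product rule over the whole index set gives the one
   for every subfamily, by taking [A i] to be the full set. *)
Definition mutually_independent d (T : measurableType d) (R : realType)
    (P : probability T R) (I : finType) (X : I -> {RV P >-> R}) : Prop :=
  forall A : I -> set R, (forall i, measurable (A i)) ->
    P (\bigcap_i (X i @^-1` A i)) = (\prod_(i : I) P (X i @^-1` A i))%E.

(* X_{n:n}; the family is indexed by ['I_n.+1] so that it is nonempty and the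
   maximum can be started at its first member. *)
Section largest_order_statistic.
Context d (T : measurableType d) (R : realType) (P : probability T R) (n : nat).
Variable X : 'I_n.+1 -> {RV P >-> R}.

Definition max_fun (w : T) : R := \big[Num.max/X ord0 w]_(i < n.+1) X i w.

Lemma measurable_max_fun : measurable_fun [set: T] max_fun.
Proof.
rewrite /max_fun; elim: (index_enum _) => [|i s IH].
  by under eq_fun do rewrite big_nil; exact: measurable_funP.
under eq_fun do rewrite big_cons.
by apply: measurable_maxr => //; exact: measurable_funP.
Qed.

HB.instance Definition _ :=
  isMeasurableFun.Build _ _ _ _ max_fun measurable_max_fun.

Definition max_rv : {RV P >-> R} := max_fun.

End largest_order_statistic.

Definition ENH_cdf (R : realType) (alpha lambda beta x : R) : R :=
  if 0 < x then (1 - expR (1 - (1 + lambda * x) `^ alpha)) `^ beta else 0.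

Definition is_ENH d (T : measurableType d) (R : realType) (P : probability T R)
    (alpha lambda beta : R) (X : {RV P >-> R}) : Prop :=
  {ae P, forall w, 0 < X w} /\
  forall x : R, cdf X x = (ENH_cdf alpha lambda beta x)%:E.

(* The supremum is taken in the extended reals: it is +oo when G <= u
   everywhere, e.g., for u = 1. *)
Definition right_cont_inverse (R : realType) (G : R -> \bar R) (u : \bar R) : \bar R :=
  ereal_sup [set x%:E | x in [set x : R | (G x <= u)%E]].

(* Convexity for functions with values in the extended reals (0 * +oo = 0);
   [convex_function] only covers real-valued functions. *)
Definition econvex_function (R : realType) (D : set R) (f : R -> \bar R) : Prop :=
  forall t x y : R, 0 <= t <= 1 -> D x -> D y ->
    (f (t * x + (1 - t) * y)%R <= t%:E * f x + (1 - t)%:E * f y)%E.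

(* X <=_c Y, for (almost surely) non-negative X and Y, possibly living on
   different probability spaces. *)
Definition convex_transform_le (R : realType)
    d (T : measurableType d) (P : probability T R) (X : {RV P >-> R})
    d' (T' : measurableType d') (Q : probability T' R) (Y : {RV Q >-> R}) : Prop :=
  econvex_function `[0, +oo[ (fun x => right_cont_inverse (cdf Y) (cdf X x)).

(* Main.v *)
Require Import Defs.
From mathcomp Require Import all_boot all_order all_algebra.
From mathcomp Require Import all_classical all_reals all_analysis.
From mathcomp Require Import ring.

(** Both maxima are again exponentiated Nadarajah-Haghighi variables: the
    distribution function of the maximum of independent variables is the product
    of the individual ones, and since within each family only the outer exponent
    varies, the product just adds these exponents ([cdf_max_ENH]).  Hence both
    maxima have the same outer exponent [B].  Let [F] and [G] be the
    distribution functions with parameters [(alpha2, lambda2, B)] and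
    [(alpha1, lambda1, B)].  The map [v |-> (1 - exp (1 - v)) ^ B], increasing
    for [v >= 1], cancels from the equation [G y = F x], and there remains
    [(1 + lambda1 y) ^ alpha1 = (1 + lambda2 x) ^ alpha2], whose solution is
    [y = ((1 + lambda2 x) ^ (alpha2 / alpha1) - 1) / lambda1]
    ([ENH_cdf_quantile]).  As [G] is strictly increasing on the half-line
    ([ENH_cdf_le]), this solution is the value at [F x] of the right continuous
    inverse of [G] ([right_cont_inverse_ENH]).  It is a convex function of [x]
    because the exponent [alpha2 / alpha1] is at least 1. *)

Import Order.TTheory GRing.Theory Num.Theory.
Local Open Scope classical_set_scope.
Local Open Scope ring_scope.

(** The maximum is at most [x] exactly when every member is, so independence
    applies to the half-lines. *)
Lemma cdf_max_rv (R : realType) (d : measure_display) (T : measurableType d)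
    (P : probability T R) (n : nat) (X : 'I_n.+1 -> {RV P >-> R}) (x : R) :
  mutually_independent X ->
  cdf (max_rv X) x = (\prod_(i < n.+1) cdf (X i) x)%E.
Proof.
move=> indep.
rewrite [RHS](_ : _ = (\prod_(i < n.+1) P (X i @^-1` `]-oo, x]))%E) //.
rewrite -(indep (fun=> `]-oo, x]%classic)) //.
rewrite /cdf /distribution /pushforward; congr (P _).
apply/seteqP; split=> w /=; rewrite in_itv /= /max_fun.
  by case/bigmax_leP=> _ le_x i _ /=; rewrite in_itv /=; exact: le_x.
move=> le_x; apply: bigmax_le => [|i _].
  by have := le_x ord0 Logic.I; rewrite /= in_itv.
by have := le_x i Logic.I; rewrite /= in_itv.
Qed.

Lemma powR_sum (R : realType) (I : Type) (s : seq I) (a : R) (b : I -> R) :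
  a != 0 -> a `^ (\sum_(i <- s) b i) = \prod_(i <- s) a `^ b i.
Proof.
move=> a0; elim: s => [|i s IH]; first by rewrite !big_nil powRr0.
by rewrite !big_cons powRD ?IH // a0 implybT.
Qed.

Section ENH.
Variable R : realType.
Implicit Types alpha lambda beta x y : R.

Lemma ENH_base_ge1 lambda x : 0 < lambda -> 0 <= x -> 1 <= 1 + lambda * x.
Proof. by move=> l0 x0; rewrite lerDl mulr_ge0 // ltW. Qed.

Lemma ENH_power_gt1 alpha lambda x : 0 < alpha -> 0 < lambda -> 0 < x ->
  1 < (1 + lambda * x) `^ alpha.
Proof.
move=> a0 l0 x0; have one_pow : 1 `^ alpha = 1 :> R by rewrite powR1.
rewrite -[ltLHS]one_pow.
apply: gt0_ltr_powR => //; rewrite ?nnegrE ?ltrDl ?mulr_gt0 //.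
by rewrite (le_trans ler01) // ENH_base_ge1 // ltW.
Qed.

Lemma ENH_outer_base_gt0 alpha lambda x : 0 < alpha -> 0 < lambda -> 0 < x ->
  0 < 1 - expR (1 - (1 + lambda * x) `^ alpha).
Proof.
by move=> a0 l0 x0; rewrite subr_gt0 expR_lt1 subr_lt0 ENH_power_gt1.
Qed.

(** For [x > 0] the base of the outer power is positive, so exponents add up; for
    [x <= 0] both sides vanish, on the left because there is a factor. *)
Lemma ENH_cdf_prod (I : Type) (s : seq I) alpha lambda x (beta : I -> R) :
  0 < alpha -> 0 < lambda -> (0 < size s)%N ->
  \prod_(i <- s) ENH_cdf alpha lambda (beta i) x =
  ENH_cdf alpha lambda (\sum_(i <- s) beta i) x.
Proof.
move=> a0 l0 s0; rewrite /ENH_cdf; case: ifPn => x0.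
  by rewrite powR_sum // gt_eqF // ENH_outer_base_gt0.
by case: s s0 => // i s _; rewrite big_cons mul0r.
Qed.

Lemma cdf_max_ENH (d : measure_display) (T : measurableType d)
    (P : probability T R) (n : nat) (X : 'I_n.+1 -> {RV P >-> R})
    alpha lambda (beta : 'I_n.+1 -> R) x :
  0 < alpha -> 0 < lambda -> mutually_independent X ->
  (forall i, is_ENH alpha lambda (beta i) (X i)) ->
  cdf (max_rv X) x = (ENH_cdf alpha lambda (\sum_(i < n.+1) beta i) x)%:E.
Proof.
move=> a0 l0 indep XE; rewrite cdf_max_rv //.
under eq_bigr do rewrite (XE _).2.
rewrite prodEFin ENH_cdf_prod //.
by rewrite /index_enum -enumT size_enum_ord.
Qed.

Lemma ENH_cdf_lt alpha lambda beta x y :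
  0 < alpha -> 0 < lambda -> 0 < beta -> 0 <= x -> x < y ->
  ENH_cdf alpha lambda beta x < ENH_cdf alpha lambda beta y.
Proof.
move=> a0 l0 b0 x0 xy; have y0 := le_lt_trans x0 xy.
rewrite /ENH_cdf y0; case: ifPn => [{}x0|_]; last first.
  by rewrite powR_gt0 // ENH_outer_base_gt0.
apply: gt0_ltr_powR; rewrite ?nnegrE ?(ltW (ENH_outer_base_gt0 _ _ _ _ _ _)) //.
rewrite ltrD2l ltrN2 ltr_expR ltrD2l ltrN2.
apply: gt0_ltr_powR; rewrite // ?nnegrE.
- by rewrite (le_trans ler01) // ENH_base_ge1 // ltW.
- by rewrite (le_trans ler01) // ENH_base_ge1 // ltW.
- by rewrite ltrD2l ltr_pM2l.
Qed.

(** Strict monotonicity on the half-line; at a negative [x] the distribution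
    function takes its least value 0. *)
Lemma ENH_cdf_le alpha lambda beta x y :
  0 < alpha -> 0 < lambda -> 0 < beta -> 0 <= y ->
  (ENH_cdf alpha lambda beta x <= ENH_cdf alpha lambda beta y) = (x <= y).
Proof.
move=> a0 l0 b0 y0; case: (ltgtP x y) => [xy|yx|->]; last exact: lexx.
- case: (leP 0 x) => x0; first by rewrite ltW // ENH_cdf_lt.
  by rewrite /ENH_cdf (le_gtF (ltW x0)); case: ifP => _; rewrite ?powR_ge0 ?lexx.
- by apply/negbTE; rewrite -ltNge ENH_cdf_lt.
Qed.

(** The function [G^-1 o F] whose convexity is at stake, [F] and [G] having the
    parameters [(alpha2, lambda2)] and [(alpha1, lambda1)] and a common outer
    exponent. *)
Definition ENH_transform alpha1 alpha2 lambda1 lambda2 x : R :=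
  ((1 + lambda2 * x) `^ (alpha2 / alpha1) - 1) / lambda1.

Section transform.
Variables alpha1 alpha2 lambda1 lambda2 : R.
Hypotheses (alpha1_gt0 : 0 < alpha1) (alpha2_gt0 : 0 < alpha2).
Hypotheses (lambda1_gt0 : 0 < lambda1) (lambda2_gt0 : 0 < lambda2).

Let h := ENH_transform alpha1 alpha2 lambda1 lambda2.

Lemma ENH_transform0 : h 0 = 0.
Proof. by rewrite /h /ENH_transform mulr0 addr0 powR1 subrr mul0r. Qed.

Lemma ENH_transform_gt0 x : 0 < x -> 0 < h x.
Proof. by move=> x0; rewrite divr_gt0 // subr_gt0 ENH_power_gt1 // divr_gt0. Qed.

Lemma ENH_cdf_quantile beta x : 0 <= x ->
  ENH_cdf alpha1 lambda1 beta (h x) = ENH_cdf alpha2 lambda2 beta x.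
Proof.
rewrite le_eqVlt => /predU1P[<-|x0]; first by rewrite ENH_transform0 /ENH_cdf ltxx.
have base : (1 + lambda1 * h x) `^ alpha1 = (1 + lambda2 * x) `^ alpha2.
  rewrite /h /ENH_transform mulrCA mulfV ?(gt_eqF lambda1_gt0) // mulr1.
  by rewrite addrC subrK -powRrM divfK // gt_eqF.
by rewrite /ENH_cdf base (ENH_transform_gt0 _ x0) x0.
Qed.

(** The sublevel set [G z <= F x = G (h x)] is the half-line [z <= h x], so its
    supremum is attained at [h x]. *)
Lemma right_cont_inverse_ENH beta (G : R -> \bar R) x : 0 < beta -> 0 <= x ->
  (forall z, G z = (ENH_cdf alpha1 lambda1 beta z)%:E) ->
  right_cont_inverse G (ENH_cdf alpha2 lambda2 beta x)%:E = (h x)%:E.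
Proof.
move=> b0 x0 GE; rewrite -ENH_cdf_quantile //.
have h0 : 0 <= h x.
  move: x0; rewrite le_eqVlt => /predU1P[<-|]; first by rewrite ENH_transform0.
  by move/ENH_transform_gt0/ltW.
apply/eqP; rewrite eq_le; apply/andP; split.
  apply/ereal_supP => _ [z /= + <-].
  by rewrite GE !lee_fin ENH_cdf_le.
by apply: ereal_sup_ubound; exists (h x); rewrite //= GE.
Qed.

Lemma ENH_transform_convex t x y : alpha1 <= alpha2 ->
  0 <= t <= 1 -> 0 <= x -> 0 <= y ->
  h (t * x + (1 - t) * y) <= t * h x + (1 - t) * h y.
Proof.
move=> le_alpha /andP[t0 t1] x0 y0.
have p1 : 1 <= alpha2 / alpha1 by rewrite ler_pdivlMr // mul1r.
have base_nneg z : 0 <= z -> 1 + lambda2 * z \in (`[0, +oo[%classic : set R).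
  move=> z0; rewrite inE /= in_itv /= andbT.
  by rewrite (le_trans ler01) // ENH_base_ge1.
have cvx : (t * (1 + lambda2 * x) + (1 - t) * (1 + lambda2 * y))
      `^ (alpha2 / alpha1) <=
    t * (1 + lambda2 * x) `^ (alpha2 / alpha1) +
    (1 - t) * (1 + lambda2 * y) `^ (alpha2 / alpha1).
  exact: (convex_powR p1 (Itv01 t0 t1) (base_nneg x x0) (base_nneg y y0)).
rewrite /h /ENH_transform !mulrA -mulrDl ler_pM2r ?invr_gt0 //.
rewrite (_ : 1 + lambda2 * (t * x + (1 - t) * y)
           = t * (1 + lambda2 * x) + (1 - t) * (1 + lambda2 * y)); last first.
  by ring.
(* The subtracted constants agree, since the weights add up to 1. *)
rewrite lerBlDr (le_trans cvx) // le_eqVlt; apply/orP; left; apply/eqP.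
by ring.
Qed.

End transform.
End ENH.

Theorem theorem3p8 (R : realType)
    (d : measure_display) (T : measurableType d) (P : probability T R)
    (d' : measure_display) (T' : measurableType d') (P' : probability T' R)
    (n : nat) (alpha1 alpha2 lambda1 lambda2 : R) (beta beta' : 'I_n.+1 -> R)
    (X : 'I_n.+1 -> {RV P >-> R}) (X' : 'I_n.+1 -> {RV P' >-> R})
    (alpha1_gt0 : 0 < alpha1) (alpha2_gt0 : 0 < alpha2)
    (lambda1_gt0 : 0 < lambda1) (lambda2_gt0 : 0 < lambda2)
    (beta_gt0 : forall i, 0 < beta i) (beta'_gt0 : forall i, 0 < beta' i)
    (X_indep : mutually_independent X) (X'_indep : mutually_independent X')
    (X_ENH : forall i, is_ENH alpha1 lambda1 (beta i) (X i))
    (X'_ENH : forall i, is_ENH alpha2 lambda2 (beta' i) (X' i))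
    (le_alpha : alpha1 <= alpha2)
    (eq_beta : \sum_(i < n.+1) beta i = \sum_(i < n.+1) beta' i) :
  convex_transform_le (max_rv X') (max_rv X).
Proof.
set B := \sum_(i < n.+1) beta i in eq_beta.
have B0 : 0 < B.
  by rewrite /B big_ord_recl ltr_wpDr ?sumr_ge0 // => i _; exact: ltW.
have GE z : cdf (max_rv X) z = (ENH_cdf alpha1 lambda1 B z)%:E.
  exact: cdf_max_ENH.
have FE z : cdf (max_rv X') z = (ENH_cdf alpha2 lambda2 B z)%:E.
  by rewrite eq_beta; exact: cdf_max_ENH.
have inverseE (z : R) : 0 <= z ->
    right_cont_inverse (cdf (max_rv X)) (cdf (max_rv X') z) =
    (ENH_transform R alpha1 alpha2 lambda1 lambda2 z)%:E.
  by move=> z0; rewrite FE; exact: (right_cont_inverse_ENH _ _ _ _ _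
    alpha1_gt0 alpha2_gt0 lambda1_gt0 lambda2_gt0 _ _ _ B0 z0 GE).
move=> t x y t01; rewrite /= !in_itv /= !andbT => x0 y0.
have /andP[t0 t1] := t01.
rewrite !inverseE ?addr_ge0 ?mulr_ge0 ?subr_ge0 //.
by rewrite -!EFinM -EFinD lee_fin ENH_transform_convex.
Qed.
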